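(* Suppose there exist $\vartheta\in(0,2]$ and $K>0$ such that $$\big\|\ell(z,\xi)-\mathbb E_{\mathbb P^\star}[\ell(z,\xi)]\big\|_{\psi_\vartheta}\le K\qquad\forall z\in\mathcal X.$$ Then there exist constants $C_\vartheta,c_\vartheta>0$, depending only on $\vartheta$, such that for every fixed $z\in\mathcal X$, $$\mathbb E_{\mathbb P^\star}[\ell(z,\xi)]-\mathbb E_{\hat{\mathbb P}_N}[\ell(z,\xi)]\le\frac{C_\vartheta K}{\sqrt N}\sqrt{1+\log\frac1\delta}$$ with probability at least $1-\delta$, provided that $$\delta\in\begin{cases}\big[2\exp(-c_\vartheta N^{\vartheta/(2-\vartheta)}),\,1\big),&\vartheta\in(0,1),\\ \big[2\exp(-c_\vartheta N),\,1\big),&\vartheta\in[1,2),\\ (0,1),&\vartheta=2.\end{cases}$$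
   Context: $\mathcal X\subseteq\mathbb R^{D_x}$ is a compact convex decision set and $\xi$ is a random vector with law $\mathbb P^\star$ on $\Xi\subseteq\mathbb R^{D_\xi}$. The loss is $\ell(x,\xi)=\max_{j\in[J]}\big(a_j(x)^\top\xi+b_j(x)\big)$ with $a_j,b_j$ affine in $x$. $\hat{\mathbb P}_N$ is the empirical distribution of $N$ i.i.d. samples $\hat\xi_1,\dots,\hat\xi_N$ from $\mathbb P^\star$, so $\mathbb E_{\hat{\mathbb P}_N}[\ell(z,\xi)]=\frac1N\sum_{i=1}^N\ell(z,\hat\xi_i)$, and probability refers to the sample. For a real random variable $X$ and $\vartheta>0$, $\|X\|_{\psi_\vartheta}=\inf\{c>0:\mathbb E[\exp((|X|/c)^\vartheta)-1]\le1\}$. *)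

(* Defs.v *)
From HB Require Import structures.
From mathcomp Require Import all_boot all_order all_algebra.
From mathcomp Require Import all_classical all_reals all_analysis.

Set Implicit Arguments.
Unset Strict Implicit.
Unset Printing Implicit Defensive.

Import Order.TTheory GRing.Theory Num.Theory.
Import numFieldTopology.Exports.

Local Open Scope classical_set_scope.
Local Open Scope ring_scope.

(* R^D with its Borel sigma-algebra, generated by the open sets of the product
   topology on column vectors. *)
Notation borel_vec R D := (g_sigma_algebraType (@open 'cV[R]_D)).

Definition affine_map (R : realType) (U V : lmodType R) (f : U -> V) : Prop :=
  exists (L : {linear U -> V}) (c : V), forall x, f x = L x + c.

(* max_j (a_j(x)^T u + b_j(x)).  The J.+1 pieces are indexed by 'I_J.+1, so the
   index set is nonempty; the neutral value of the iterated maximum is one of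
   the pieces, hence it does not alter the maximum. *)
Definition max_affine_loss (R : realType) (Dx Dxi J : nat)
    (a : 'I_J.+1 -> 'cV[R]_Dx -> 'cV[R]_Dxi) (b : 'I_J.+1 -> 'cV[R]_Dx -> R)
    (x : 'cV[R]_Dx) (u : 'cV[R]_Dxi) : R :=
  let piece j := ((a j x)^T *m u) ord0 ord0 + b j x in
  \big[Num.max/piece ord0]_(j < J.+1) piece j.

(* The infimum is taken in the extended reals: the norm is +oo when no c is
   admissible. *)
Definition psi_norm (R : realType) (d : measure_display) (T : measurableType d)
    (P : probability T R) (theta : R) (X : T -> R) : \bar R :=
  ereal_inf [set c%:E | c in [set c : R | 0 < c /\
    ('E_P[(fun w => expR ((`|X w| / c) `^ theta) - 1)%R] <= 1)%E]].

Definition mutually_independent (R : realType) (d d' : measure_display)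
    (T : measurableType d) (T' : measurableType d') (P : probability T R)
    (I : finType) (X : I -> {RV P >-> T'}) : Prop :=
  forall (S : {set I}) (A : I -> set T'),
    (forall i, measurable (A i)) ->
    P (\bigcap_(i in [set` S]) (X i @^-1` A i)) =
    (\prod_(i in S) P (X i @^-1` A i))%E.

Definition iid_sample (R : realType) (d d' : measure_display)
    (T : measurableType d) (T' : measurableType d') (P : probability T R)
    (Q : probability T' R) (N : nat) (X : 'I_N -> {RV P >-> T'}) : Prop :=
  mutually_independent X /\
  forall i (A : set T'), measurable A -> distribution P (X i) A = Q A.

(* Expectation of f under the empirical distribution of the points u. *)
Definition empirical_mean (R : realType) (T : Type) (N : nat)
    (u : 'I_N -> T) (f : T -> R) : R :=
  N%:R^-1 * \sum_(i < N) f (u i).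

Definition admissible_delta (R : realType) (theta c : R) (N : nat) : set R :=
  if theta < 1 then `[2 * expR (- (c * N%:R `^ (theta / (2 - theta)))), 1[%classic
  else if theta < 2 then `[2 * expR (- (c * N%:R)), 1[%classic
  else `]0, 1[%classic.

(* Main.v *)
Require Import Defs.
From HB Require Import structures.
From mathcomp Require Import all_boot all_order all_algebra.
From mathcomp Require Import all_classical all_reals all_analysis.
From mathcomp Require Import measurable_realfun ring lra.

(** A one-sided concentration bound for the mean of an i.i.d. sample of a
    sub-Weibull variable, by truncation from above and an exponential moment.

    Rescale the deviation to Z = (E f - f) / c, where c < 2 K and
    E exp (|Z|^theta) <= 2.  Only large positive values of Z matter, so Z is
    replaced by min (Z, B).  Cutting from above keeps the mean nonpositive, so
    that, unlike a two-sided truncation, it leaves no drift to estimate.  From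
    exp y <= 1 + y + y^2 exp (max (y, 0)), and because a quadratic factor is
    absorbed by half of the exponential weight (sqr_le_expR_powR), one gets

      E exp (lam min (Z, B)) <= exp (V lam^2),

    with V depending on theta only, as soon as lam min (x, B) is at most
    x^theta / 2 up to terms of order 1 + lam^2 (truncated_mgf_le).  Independence
    turns this into a Gaussian tail for the truncated sum, and the truncation is
    paid for by the probability that some Z_i exceeds B, at most
    2 N exp (- B^theta) (sample_sum_tail).

    Put L = 1 + log (1 / delta).  Take lam = sqrt (L / (N V)), optimal for the
    deviation s = 2 sqrt (V N L) of the sum, and B with
    B^theta = log (4 N / delta).  The first term is then exp (- L) <= delta / 2
    and the second one is delta / 2 (tail_bound_le).  What remains is the
    condition on lam and B, and it is exactly what the range of delta grants:
    - for theta < 1 it is lam B^(1 - theta) <= 1 / 2, and both factors scale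
      inversely when L is of order N^(theta / (2 - theta)), for then
      log (4 N / delta) has that order too;
    - for 1 <= theta < 2 it is lam <= 1 / 2, that is, L at most of order N;
    - for theta = 2 it always holds, by completing a square.

    The product formula for expectations is derived from the product formula
    for events by replacing indicators with general functions one index at a
    time (mutually_independent_integral_prod). *)

Set Implicit Arguments.
Unset Strict Implicit.

Import Order.TTheory GRing.Theory Num.Theory.
Import numFieldTopology.Exports.

Local Open Scope classical_set_scope.
Local Open Scope ring_scope.

(** * Expectation of a product of independent factors *)

Section independence.
Context {R : realType} {d d' : measure_display}
  {T : measurableType d} {T' : measurableType d'}.
Import HBNNSimple.

(** The hypothesis says that the image under X of the measure with density G is
    c times Q, tested on sets; monotone convergence along simple functions
    extends the identity to nonnegative functions.  It is the step that replaces
    one indicator by a general factor. *)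
Lemma ge0_integral_weighted_comp (P : {measure set T -> \bar R})
    (Q : {measure set T' -> \bar R}) (X : T -> T') (G : T -> R) (c : R)
    (f : T' -> R) :
  measurable_fun [set: T] X -> measurable_fun [set: T] G ->
  (forall w, 0 <= G w) -> 0 <= c ->
  measurable_fun [set: T'] f -> (forall x, 0 <= f x) ->
  (forall A, measurable A ->
    (\int[P]_w (G w * \1_A (X w))%:E = c%:E * Q A)%E) ->
  (\int[P]_w (G w * f (X w))%:E = c%:E * \int[Q]_x (f x)%:E)%E.
Proof.
move=> mX mG G0 c0 mf f0 h.
have mfE : measurable_fun [set: T'] (EFin \o f : T' -> \bar R) by exact/measurable_EFinP.
pose g := nnsfun_approx measurableT mfE.
have cvg_g x : ((EFin \o g^~ x) @ \oo --> (f x)%:E)%E.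
  by apply: (cvg_nnsfun_approx measurableT mfE) => // y _; rewrite lee_fin.
have mgX n : measurable_fun [set: T] (g n \o X) by apply: measurableT_comp.
have nd_g x : {homo g^~ x : n m / (n <= m)%N >-> n <= m}.
  by move=> n m nm; exact/lefP/nd_nnsfun_approx.
have step n : (\int[P]_w (G w * g n (X w))%:E =
    c%:E * \int[Q]_x (g n x)%:E)%E.
  have mind r : measurable_fun [set: T] (fun w => \1_(g n @^-1` [set r]) (X w) : R).
    by apply: (measurableT_comp (measurable_indic _) mX).
  transitivity (\int[P]_w (\sum_(y \in range (g n))
     (y%:E * (G w * \1_(g n @^-1` [set y]) (X w))%:E)))%E.
    apply: eq_integral => w _; rewrite (fimfunE (g n)).
    rewrite !fsbig_finite//= mulr_sumr -sumEFin; apply: eq_bigr => y _.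
    by rewrite -EFinM mulrCA.
  rewrite ge0_integral_fsum//; last 2 first.
  - move=> y; apply: measurable_funeM; apply/measurable_EFinP.
    exact: measurable_funM.
  - move=> y w _; rewrite -EFinM lee_fin mulrCA mulr_ge0//.
    by rewrite -lee_fin EFinM; exact: nnfun_muleindic_ge0.
  rewrite (integralT_nnsfun Q (g n)) sintegralE ge0_mule_fsumr; last first.
    by move=> y; exact: nnsfun_mulemu_ge0.
  apply: eq_fsbigr => y /[!inE] -[x _ <-].
  rewrite ge0_integralZl_EFin//; first by rewrite h// muleCA.
  - by move=> w _; rewrite lee_fin mulr_ge0.
  - by apply/measurable_EFinP; exact: measurable_funM.
have lhs : ((fun n => \int[P]_w (G w * g n (X w))%:E) @ \oo
    --> \int[P]_w (G w * f (X w))%:E)%E.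
  rewrite (_ : (\int[P]_w (G w * f (X w))%:E)%E =
    (\int[P]_w (limn (fun n => (G w * g n (X w))%:E)))%E); last first.
    apply: eq_integral => w _; apply/esym/cvg_lim => //.
    under eq_fun do rewrite EFinM.
    by rewrite EFinM; apply: cvgeZl => //; exact: cvg_g.
  apply: cvg_monotone_convergence => //.
  - by move=> n; apply/measurable_EFinP; exact: (measurable_funM mG (mgX n)).
  - by move=> n w _; rewrite lee_fin mulr_ge0.
  - by move=> w _ n m nm; rewrite lee_fin ler_wpM2l// nd_g.
have rhs : ((fun n => c%:E * \int[Q]_x (g n x)%:E) @ \oo
    --> c%:E * \int[Q]_x (f x)%:E)%E.
  apply: cvgeZl => //.
  rewrite (_ : (\int[Q]_x (f x)%:E)%E =
    (\int[Q]_x (limn (fun n => (g n x)%:E)))%E); last first.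
    by apply: eq_integral => x _; apply/esym/cvg_lim => //; exact: cvg_g.
  apply: cvg_monotone_convergence => //.
  - by move=> n; exact/measurable_EFinP.
  - by move=> n x _; rewrite lee_fin.
  - by move=> x _ n m nm; rewrite lee_fin nd_g.
move: lhs; under eq_fun do rewrite step.
by move/(cvg_unique _ rhs) => /(_ (@ereal_hausdorff R)).
Qed.

(** When every factor is an indicator this is the definition of independence.
    The indices carrying a general factor form a list; removing its head k, the
    product over the other indices plays the role of the density G, and the
    induction hypothesis is used with the factor at k replaced by an arbitrary
    indicator. *)
Lemma mutually_independent_integral_prod (P : probability T R) (I : finType)
    (X : I -> {RV P >-> T'}) (f : I -> T' -> R) (m : I -> R) :
  mutually_independent X ->
  (forall i, measurable_fun [set: T'] (f i)) -> (forall i x, 0 <= f i x) ->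
  (forall i, \int[P]_w (f i (X i w))%:E = (m i)%:E)%E ->
  (\int[P]_w (\prod_i f i (X i w))%:E = (\prod_i m i)%:E)%E.
Proof.
move=> indX.
suff main (s : seq I) : forall (f : I -> T' -> R) (m : I -> R),
    (forall i, i \notin s -> exists2 A, measurable A & f i = \1_A) ->
    (forall i, measurable_fun [set: T'] (f i)) -> (forall i x, 0 <= f i x) ->
    (forall i, \int[P]_w (f i (X i w))%:E = (m i)%:E)%E ->
    (\int[P]_w (\prod_i f i (X i w))%:E = (\prod_i m i)%:E)%E.
  by apply: (main (enum I)) => i; rewrite mem_enum.
elim: s => {f m} [|k s IH] f m find mf f0 fm.
  have /choice[A mA] : forall i, exists A, measurable A /\ f i = \1_A.
    by move=> i; have [//|A ? ?] := find i; exists A.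
  have fE i : f i = \1_(A i) by case: (mA i).
  have mXA i : measurable (X i @^-1` A i).
    by apply: measurable_funPTI; case: (mA i).
  have PE i : P (X i @^-1` A i) = (m i)%:E.
    by rewrite -fm fE -[_ @^-1` _]setIT -integral_indic.
  have PI : P (\bigcap_(i in [set` [set: I]%SET]) (X i @^-1` A i)) =
      (\prod_i m i)%:E.
    rewrite indX; last by move=> i; case: (mA i).
    by rewrite -prodEFin; apply: eq_big => [i|i _]; rewrite ?finset.in_setT ?PE.
  rewrite -PI; rewrite -[\bigcap_(i in _) _]setIT -integral_indic//; last first.
    by apply: fin_bigcap_measurable.
  apply: eq_integral => w _; congr EFin.
  rewrite indicE; case: (boolP (w \in _)) => [|].
    rewrite inE => wA; rewrite big1// => i _.
    by rewrite fE indicE mem_set//; apply: wA => /=; rewrite finset.in_setT.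
  rewrite notin_setE => wA; apply/eqP; rewrite prodf_seq_eq0/=.
  apply: contra_notT wA => /hasPn wA i _ /=.
  have := wA i; rewrite mem_index_enum => /(_ isT).
  by rewrite fE indicE; case: (boolP (_ \in _)) => [/set_mem//|]; rewrite eqxx.
(* the family with an indicator at k, where the hypothesis on weighted
   indicators is to be checked *)
pose g A i := if i == k then \1_A else f i.
pose mu A i := if i == k then fine (P (X k @^-1` A)) else m i.
have m0 i : 0 <= m i.
  by rewrite -lee_fin -fm; apply: integral_ge0 => w _; rewrite lee_fin.
have mfX i : measurable_fun [set: T] (fun w => f i (X i w)).
  by apply: measurableT_comp.
rewrite (bigD1 k)//= mulrC EFinM -fm.
rewrite -[X in (_ * X)%E](ge0_integral_distribution (X k) (f := EFin \o f k))//; last 2 first.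
- exact/measurable_EFinP.
- by move=> y; rewrite /= lee_fin.
rewrite -(ge0_integral_weighted_comp (P := P) (Q := distribution P (X k)) (X := X k)
    (G := fun w => \prod_(i | i != k) f i (X i w)))//.
- by apply: eq_integral => w _; rewrite (bigD1 k)//= mulrC.
- under eq_fun do rewrite big_mkcond; apply: measurable_prod => i _.
  by case: (i != k); [exact: mfX|exact: measurable_cst].
- by move=> w; apply: prodr_ge0.
- exact: prodr_ge0.
move=> A mA.
have gk x : g A k x = \1_A x by rewrite /g eqxx.
have gi i : i != k -> (g A i = f i) * (mu A i = m i).
  by rewrite /g /mu => /negPf ->.
have mXA : measurable (X k @^-1` A) by apply: measurable_funPTI.
transitivity (\int[P]_w (\prod_i g A i (X i w))%:E)%E.
  apply: eq_integral => w _; rewrite [in RHS](bigD1 k)//= gk mulrC; congr (_ * _)%:E.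
  by apply: eq_bigr => i /gi ->.
rewrite (IH (g A) (mu A)).
- rewrite (bigD1 k)//= {1}/mu eqxx mulrC EFinM fineK ?fin_num_measure//.
  by congr (_%:E * _)%E; apply: eq_bigr => i /gi ->.
- move=> i si; rewrite /g; case: eqVneq => [_|ik]; first by exists A.
  by apply: find; rewrite inE negb_or ik.
- by move=> i; rewrite /g; case: eqP => // _; exact: measurable_indic.
- by move=> i x; rewrite /g; case: eqP => // _; rewrite indicE.
- move=> i; rewrite /g /mu; case: eqVneq => [->|//].
  by rewrite fineK ?fin_num_measure// -[X k @^-1` A]setIT -integral_indic.
Qed.

End independence.

(** * Elementary bounds on the exponential *)

Lemma expR_sub1_le (R : realType) (x : R) : expR x - 1 <= x * expR x.
Proof.
have h := expR_ge1Dx (- x); have := ler_wpM2r (expR_ge0 x) h.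
by rewrite expRN mulVf ?gt_eqF ?expR_gt0// mulrDl mul1r mulNr; lra.
Qed.

(** The exponential in the remainder sees only the positive part of x: this is
    why a truncation from above suffices. *)
Lemma expR_le_quadratic (R : realType) (x : R) :
  expR x <= 1 + x + x ^+ 2 * expR (Num.max x 0).
Proof.
have h1 := expR_sub1_le x; have h2 := expR_ge1Dx x.
have [x0|x0] := leP 0 x.
  by nra.
by rewrite expR0; nra.
Qed.

Lemma expR_half_le2 (R : realType) : expR (2^-1 : R) <= 2.
Proof. have := expR_sub1_le (2^-1 : R); lra. Qed.

Lemma ln2_ge_half (R : realType) : 2^-1 <= ln (2 : R).
Proof. by rewrite -ler_expR lnK ?posrE// expR_half_le2. Qed.

(** With q = 2 / theta and y = z^theta / 2, z^2 = (2 q)^q (y / q)^q, and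
    y / q <= exp (y / q). *)
Lemma sqr_le_expR_powR (R : realType) (theta z : R) : 0 < theta -> 0 <= z ->
  z ^+ 2 <= (4 / theta) `^ (2 / theta) * expR (z `^ theta / 2).
Proof.
move=> t0 z0; set q := 2 / theta; set y := z `^ theta / 2.
have q0 : 0 < q by rewrite divr_gt0.
have y0 : 0 <= y by rewrite divr_ge0// powR_ge0.
have -> : z ^+ 2 = (4 / theta * (y / q)) `^ q.
  rewrite -powR_mulrn// (_ : 4 / theta * (y / q) = z `^ theta); last first.
    by rewrite /y /q; field; rewrite gt_eqF.
  by rewrite -powRrM; congr (_ `^ _); rewrite /q; field; rewrite gt_eqF.
have qV : 0 <= q^-1 by rewrite invr_ge0 ltW.
have yq0 : 0 <= y / q by rewrite mulr_ge0.
rewrite powRM//; last by rewrite divr_ge0// ltW.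
apply: ler_wpM2l; first exact: powR_ge0.
have -> : expR y = expR (y / q) `^ q.
  by rewrite -expRM; congr expR; field; rewrite gt_eqF.
apply: ge0_ler_powR; rewrite ?nnegrE ?expR_ge0//; first exact: ltW.
by apply: le_trans (expR_ge1Dx _); lra.
Qed.

(** * Exponential moment of a variable truncated from above *)

Section one_variable.
Context {R : realType} {d : measure_display} {T : measurableType d}.

Lemma measurable_set_ler (f g : T -> R) :
  measurable_fun [set: T] f -> measurable_fun [set: T] g ->
  measurable [set w | f w <= g w].
Proof.
move=> mf mg; rewrite -[X in measurable X]setTI.
have mT : measurable [set true] by [].
exact: (measurable_fun_ler mf mg measurableT mT).
Qed.

(** Stated without a scaling parameter: it serves both for the truncated sum,
    with h = lam times the sum, and for the exceedances, with h = |Z|^theta. *)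
Lemma expR_markov (P : {measure set T -> \bar R}) (h : T -> R) (a : R) :
  measurable_fun [set: T] h ->
  (P [set w | (a <= h w)%R] <= (expR (- a))%:E * \int[P]_w (expR (h w))%:E)%E.
Proof.
move=> mh; rewrite expRN lee_pdivlMl ?expR_gt0//.
have mA : measurable [set w | a <= h w] by exact: measurable_set_ler.
rewrite -[X in P X]setTI setIC -integral_indic// -ge0_integralZl_EFin//; last first.
  by apply/measurable_EFinP; exact: measurable_indic.
apply: ge0_le_integral => //.
- by apply: measurable_funeM; apply/measurable_EFinP; exact: measurable_indic.
- by apply/measurable_EFinP; apply: measurableT_comp.
move=> w _; rewrite -EFinM lee_fin indicE.
have [/set_mem/= aw|_] := boolP (w \in _).
  by rewrite mulr1 ler_expR.
by rewrite mulr0 expR_ge0.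
Qed.

(** The variance factor V of the exponential moment: four times the constant of
    [sqr_le_expR_powR], plus one to absorb the factors exp (lam^2 / 2). *)
Definition mgf_const (theta : R) : R := 4 * (4 / theta) `^ (2 / theta) + 1.

Variables (Q : probability T R) (theta : R) (Z : T -> R).
Hypothesis theta0 : 0 < theta.
Hypothesis mZ : measurable_fun [set: T] Z.
Hypothesis Z_exp : (\int[Q]_x (expR (`|Z x| `^ theta))%:E <= 2%:E)%E.

Let mexpZ : measurable_fun [set: T] (fun x => expR (`|Z x| `^ theta)).
Proof.
apply: measurableT_comp => //.
by apply: (measurableT_comp (measurable_powR theta)); exact: measurableT_comp.
Qed.

Lemma integrable_exp_powR :
  Q.-integrable [set: T] (fun x => (expR (`|Z x| `^ theta))%:E).
Proof.
apply/integrableP; split; first exact/measurable_EFinP.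
under eq_integral do rewrite gee0_abs ?lee_fin ?expR_ge0//.
by apply: le_lt_trans Z_exp _; rewrite ltey.
Qed.

Lemma integrable_of_exp_powR : Q.-integrable [set: T] (EFin \o Z).
Proof.
pose A := (4 / theta) `^ (2 / theta).
apply: (@le_integrable _ _ _ Q [set: T] measurableT _
   (fun x => (1 + A)%:E * (expR (`|Z x| `^ theta))%:E)%E).
- exact/measurable_EFinP.
- move=> x _ /=; rewrite lee_fin [leRHS]ger0_norm; last first.
    by rewrite mulr_ge0 ?expR_ge0// addr_ge0// powR_ge0.
  have h := sqr_le_expR_powR theta0 (normr_ge0 (Z x)).
  have u0 : 0 <= `|Z x| `^ theta by exact: powR_ge0.
  have h1 : 1 <= expR (`|Z x| `^ theta) by rewrite -expR0 ler_expR.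
  have h2 : expR (`|Z x| `^ theta / 2) <= expR (`|Z x| `^ theta).
    by rewrite ler_expR; lra.
  have A0 : 0 <= A by exact: powR_ge0.
  rewrite -/A in h.
  have : `|Z x| <= 1 + `|Z x| ^+ 2 by nra.
  by nra.
- by apply: integrableZl => //; exact: integrable_exp_powR.
Qed.

(** The linear term of [expR_le_quadratic] integrates to at most zero, since
    min (Z, B) <= Z.  In the quadratic term, half of the weight exp (|Z|^theta)
    absorbs Z^2 and the other half absorbs exp (lam min (Z, B)), by the
    hypothesis on lam and B.  That hypothesis is the only place where the three
    regimes of theta differ. *)
Lemma truncated_mgf_le (lam B : R) : 0 <= lam -> 0 <= B ->
  (\int[Q]_x (Z x)%:E <= 0)%E ->
  (forall x, 0 <= x ->
    lam * Num.min x B <= x `^ theta / 2 + 2^-1 + lam ^+ 2 / 2) ->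
  (\int[Q]_x (expR (lam * Num.min (Z x) B))%:E <=
    (expR (mgf_const theta * lam ^+ 2))%:E)%E.
Proof.
move=> lam0 B0 EZ H.
pose A : R := (4 / theta) `^ (2 / theta).
have A0 : 0 <= A by exact: powR_ge0.
pose k : R := A * lam ^+ 2 * expR (2^-1 + lam ^+ 2 / 2).
have k0 : 0 <= k by rewrite !mulr_ge0// ?expR_ge0// sqr_ge0.
have pt x : expR (lam * Num.min (Z x) B) <=
    1 + lam * Z x + k * expR (`|Z x| `^ theta).
  apply: (le_trans (expR_le_quadratic _)).
  have minZ : Num.min (Z x) B <= Z x by rewrite ge_min lexx.
  apply: lerD; first by rewrite lerD2l ler_wpM2l.
  have u0 : 0 <= `|Z x| `^ theta by exact: powR_ge0.
  have sq : (Num.min (Z x) B) ^+ 2 <= `|Z x| ^+ 2.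
    rewrite -[leLHS]real_normK ?num_real// ler_sqr ?nnegrE//.
    have [//|BZ] := leP (Z x) B.
    by rewrite (ger0_norm B0) (le_trans (ltW BZ))// ler_norm.
  have := sqr_le_expR_powR theta0 (normr_ge0 (Z x)).
  rewrite -/A => /(le_trans sq) {}sq.
  have mx : Num.max (lam * Num.min (Z x) B) 0 <=
      `|Z x| `^ theta / 2 + 2^-1 + lam ^+ 2 / 2.
    rewrite ge_max; apply/andP; split; last first.
      by have := sqr_ge0 lam; lra.
    apply: le_trans (H `|Z x| (normr_ge0 _)).
    apply: ler_wpM2l => //; rewrite le_min !ge_min lexx orbT andbT.
    by rewrite ler_norm.
  rewrite exprMn (_ : k * _ = lam ^+ 2 * (A * expR (`|Z x| `^ theta / 2)) *
     expR (`|Z x| `^ theta / 2 + 2^-1 + lam ^+ 2 / 2)); last first.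
    rewrite /k {1}(_ : `|Z x| `^ theta = `|Z x| `^ theta / 2 + `|Z x| `^ theta / 2).
      by rewrite !expRD; ring.
    lra.
  apply: ler_pM; rewrite ?expR_ge0//.
  - by rewrite mulr_ge0 ?sqr_ge0.
  - by rewrite ler_wpM2l ?sqr_ge0.
  by rewrite ler_expR.
have iZ := integrable_of_exp_powR; have iE := integrable_exp_powR.
have i1 : Q.-integrable [set: T] (fun x => (1 + lam * Z x)%:E).
  under eq_fun do rewrite EFinD EFinM.
  apply: integrableD => //; first exact: finite_measure_integrable_cst.
  exact: integrableZl.
have i2 : Q.-integrable [set: T] (fun x => (k * expR (`|Z x| `^ theta))%:E).
  by under eq_fun do rewrite EFinM; exact: integrableZl.
apply: (@le_trans _ _ (\int[Q]_x (1 + lam * Z x + k * expR (`|Z x| `^ theta))%:E)%E).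
  apply: ge0_le_integral => //.
  - apply/measurable_EFinP; apply: measurableT_comp => //.
    by apply: measurable_funM => //; exact: measurable_minr.
  - under eq_fun do rewrite EFinD.
    by apply: (measurable_int Q); exact: integrableD.
  - by move=> x _; rewrite lee_fin.
under eq_integral do rewrite EFinD.
rewrite integralD//.
under eq_integral do rewrite EFinD EFinM.
rewrite integralD//; last 2 first.
- exact: finite_measure_integrable_cst.
- exact: integrableZl.
rewrite integral_cst// [X in (1 * X)%E](probability_setT Q) mule1 integralZl//.
under [X in (_ + X)%E]eq_integral do rewrite EFinM.
rewrite integralZl//.
apply: (@le_trans _ _ (1 + 0 + k%:E * 2%:E)%E).
  apply: leeD; last by apply: lee_wpmul2l; rewrite ?lee_fin.
  by apply: leeD => //; rewrite mule_ge0_le0// lee_fin.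
rewrite adde0 -EFinM -EFinD lee_fin.
rewrite (_ : mgf_const theta * lam ^+ 2 =
  lam ^+ 2 / 2 + (4 * A * lam ^+ 2 + lam ^+ 2 / 2)); last first.
  by rewrite /mgf_const -/A; field.
have s0 := sqr_ge0 lam.
rewrite expRD.
(* it remains to compare 1 + 2 A lam^2 exp (1/2 + lam^2 / 2), where
   exp (1/2) <= 2, with exp ((4 A + 1) lam^2) *)
have h1 : 1 + 4 * A * lam ^+ 2 <= expR (4 * A * lam ^+ 2 + lam ^+ 2 / 2).
  by apply: le_trans (expR_ge1Dx _); lra.
have h2 : 1 <= expR (lam ^+ 2 / 2) by rewrite -[leLHS]expR0 ler_expR; lra.
apply: (@le_trans _ _ (expR (lam ^+ 2 / 2) * (1 + 4 * A * lam ^+ 2))); last first.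
  by apply: ler_wpM2l => //; exact: expR_ge0.
rewrite /k expRD [leRHS]mulrDr [X in _ <= X + _]mulr1; apply: lerD => //.
have h3 := expR_half_le2 R.
rewrite (_ : A * _ * _ * 2 =
  expR (lam ^+ 2 / 2) * (A * lam ^+ 2 * (2 * expR 2^-1))); last by ring.
apply: ler_wpM2l; first exact: expR_ge0.
rewrite (_ : 4 * A * _ = A * lam ^+ 2 * 4); last by ring.
by apply: ler_wpM2l; [rewrite mulr_ge0|lra].
Qed.

End one_variable.

(** * Upper tail of a sum over an i.i.d. sample *)

Section sample_tail.
Context {R : realType} {d d' : measure_display}
  {T : measurableType d} {T' : measurableType d'}.
Variables (P : probability T R) (Q : probability T' R) (N : nat)
  (X : 'I_N -> {RV P >-> T'}) (iidX : iid_sample Q X).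

Lemma iid_sample_integral (f : T' -> R) (i : 'I_N) :
  measurable_fun [set: T'] f -> (forall x, 0 <= f x) ->
  (\int[P]_w (f (X i w))%:E = \int[Q]_x (f x)%:E)%E.
Proof.
move=> mf f0.
rewrite -[LHS](ge0_integral_distribution (X i) (f := EFin \o f)); last 2 first.
- exact/measurable_EFinP.
- by move=> y; rewrite /= lee_fin.
by apply: eq_measure_integral => A mA _; exact: iidX.2.
Qed.

Lemma le_measure_bigsetU (I : finType) (E : I -> set T) :
  (forall i, measurable (E i)) ->
  (P (\big[setU/set0]_i E i) <= \sum_i P (E i))%E.
Proof.
move=> mE.
suff [] : measurable (\big[setU/set0]_i E i) /\
    (P (\big[setU/set0]_i E i) <= \sum_i P (E i))%E by [].
elim/big_rec2 : _ => [|i y A _ [mA Ay]]; first by rewrite measure0.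
split; first exact: measurableU.
by apply: le_trans (measureU2 _ _ _) _ => //; exact: leeD.
Qed.

Variables (theta : R) (Z : T' -> R).
Hypothesis theta0 : 0 < theta.
Hypothesis mZ : measurable_fun [set: T'] Z.
Hypothesis Z_exp : (\int[Q]_x (expR (`|Z x| `^ theta))%:E <= 2%:E)%E.
Hypothesis Z_mean : (\int[Q]_x (Z x)%:E <= 0)%E.

(** Independence makes the exponential moment of the sum the N-th power of the
    one bounded in [truncated_mgf_le], which is finite thanks to truncation. *)
Lemma truncated_sum_tail (lam B s : R) : 0 <= lam -> 0 <= B ->
  (forall x, 0 <= x ->
    lam * Num.min x B <= x `^ theta / 2 + 2^-1 + lam ^+ 2 / 2) ->
  (P [set w | (lam * s <= \sum_i lam * Num.min (Z (X i w)) B)%R] <=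
    (expR (N%:R * (mgf_const theta * lam ^+ 2) - lam * s))%:E)%E.
Proof.
move=> lam0 B0 H.
have mg : measurable_fun [set: T'] (fun x => lam * Num.min (Z x) B).
  by apply: measurable_funM => //; exact: measurable_minr.
have mgX i : measurable_fun [set: T] (fun w => lam * Num.min (Z (X i w)) B).
  by apply: (measurableT_comp mg).
have mexpg : measurable_fun [set: T'] (fun x => expR (lam * Num.min (Z x) B)).
  exact: measurableT_comp.
have mgf := truncated_mgf_le theta0 mZ Z_exp lam0 B0 Z_mean H.
set V := mgf_const theta * lam ^+ 2 in mgf *.
have mgf_ge0 : (0 <= \int[Q]_x (expR (lam * Num.min (Z x) B))%:E)%E.
  by apply: integral_ge0 => x _; rewrite lee_fin expR_ge0.
set m := (\int[Q]_x _)%E in mgf mgf_ge0.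
have mfin : (m \is a fin_num)%E.
  by rewrite ge0_fin_numE// (le_lt_trans mgf)// ltey.
have prodE : (\int[P]_w (expR (\sum_i lam * Num.min (Z (X i w)) B))%:E =
    (\prod_(i < N) fine m)%:E)%E.
  rewrite -(mutually_independent_integral_prod (X := X)
    (f := fun _ x => expR (lam * Num.min (Z x) B)) (m := fun=> fine m))//.
  - by apply: eq_integral => w _; rewrite expR_sum.
  - exact: iidX.1.
  - by move=> i; rewrite (iid_sample_integral (f := fun x => expR (lam * Num.min (Z x) B)))// fineK.
apply: (le_trans (expR_markov _ _ _)).
  by apply: measurable_sum.
rewrite prodE -EFinM lee_fin addrC expRD; apply: ler_wpM2l; first exact: expR_ge0.
rewrite expRM_natl prodr_const card_ord; apply: lerXn2r; rewrite ?nnegrE ?expR_ge0//.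
  exact: fine_ge0.
by rewrite -lee_fin fineK.
Qed.

Lemma sample_exceedance (B : R) : 0 <= B ->
  (P (\big[setU/set0]_i [set w | (B `^ theta <= `|Z (X i w)| `^ theta)%R]) <=
    (N%:R * (2 * expR (- B `^ theta)))%:E)%E.
Proof.
move=> B0.
have mh : measurable_fun [set: T'] (fun x => `|Z x| `^ theta).
  by apply: (measurableT_comp (measurable_powR theta)); exact: measurableT_comp.
have mhX i : measurable_fun [set: T] (fun w => `|Z (X i w)| `^ theta).
  by apply: (measurableT_comp mh).
apply: (le_trans (le_measure_bigsetU _)).
  by move=> i; exact: measurable_set_ler.
apply: (@le_trans _ _ (\sum_(i < N) (2 * expR (- B `^ theta))%:E)%E); last first.
  by rewrite sumEFin sumr_const card_ord lee_fin [N%:R * _]mulr_natl.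
apply: lee_sum => i _; apply: (le_trans (expR_markov _ _ _)); first exact: mhX.
rewrite (iid_sample_integral (f := fun x => expR (`|Z x| `^ theta))); last 2 first.
- by apply: measurableT_comp => //.
- by move=> x; exact: expR_ge0.
by rewrite mulrC EFinM; apply: lee_wpmul2l; rewrite ?lee_fin ?expR_ge0.
Qed.

(** Either no summand exceeds B, and then truncation does not change the sum, or
    one of them does. *)
Lemma sample_sum_tail (lam B s : R) : 0 <= lam -> 0 <= B ->
  (forall x, 0 <= x ->
    lam * Num.min x B <= x `^ theta / 2 + 2^-1 + lam ^+ 2 / 2) ->
  (P [set w | (s <= \sum_i Z (X i w))%R] <=
    (expR (N%:R * (mgf_const theta * lam ^+ 2) - lam * s) +
     N%:R * (2 * expR (- B `^ theta)))%:E)%E.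
Proof.
move=> lam0 B0 H.
have mZX i : measurable_fun [set: T] (fun w => Z (X i w)).
  by apply: (measurableT_comp mZ).
have mA : measurable [set w | lam * s <= \sum_i lam * Num.min (Z (X i w)) B].
  apply: measurable_set_ler => //; apply: measurable_sum => i.
  by apply: measurable_funM => //; exact: measurable_minr.
have mE i : measurable [set w | B `^ theta <= `|Z (X i w)| `^ theta].
  apply: measurable_set_ler => //; apply: (measurableT_comp (measurable_powR theta)).
  exact: measurableT_comp.
have mU : measurable (\big[setU/set0]_i [set w | B `^ theta <= `|Z (X i w)| `^ theta]).
  exact: bigsetU_measurable.
rewrite EFinD; apply: le_trans (leeD (truncated_sum_tail s lam0 B0 H)
  (sample_exceedance B0)).
apply: le_trans (measureU2 _ _ _) => //.
apply: le_measure; rewrite ?inE//.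
- by apply: measurable_set_ler => //; exact: measurable_sum.
- exact: measurableU.
move=> w /= sZ.
have [[i BZ]|small] := pselect (exists i, B < Z (X i w)).
  right; rewrite -bigcup_seq; exists i => /=; first by rewrite mem_index_enum.
  apply: ge0_ler_powR; rewrite ?nnegrE ?normr_ge0 ?(ltW theta0)//.
  by apply: le_trans (ltW BZ) _; exact: ler_norm.
left; rewrite -mulr_sumr; apply: ler_wpM2l => //; apply: (le_trans sZ).
apply: ler_sum => i _; rewrite le_min lexx/=.
by rewrite leNgt; apply/negP => BZ; apply: small; exists i.
Qed.

End sample_tail.

(** * Choice of the tilt and of the truncation level *)

Section parameters.
Context {R : realType}.
Implicit Types theta lam B x delta c : R.

Lemma sqr_powR (a e : R) : (a `^ e) ^+ 2 = a `^ (2 * e).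
Proof. by rewrite -powR_mulrn ?powR_ge0// -powRrM mulrC. Qed.

(** Split y = min (x, B) as y^theta y^(1 - theta), and bound the first factor by
    x^theta and the second one by B^(1 - theta). *)
Lemma truncated_linear_le_powR theta lam B x : 0 < theta <= 1 -> 0 <= lam ->
  0 <= x -> 0 <= B -> lam * B `^ (1 - theta) <= 2^-1 ->
  lam * Num.min x B <= x `^ theta / 2.
Proof.
move=> /andP[t0 t1] lam0 x0 B0 lamB; set y := Num.min x B.
have y0 : 0 <= y by rewrite le_min x0.
have yx : y `^ theta <= x `^ theta.
  by apply: ge0_ler_powR; rewrite ?nnegrE ?(ltW t0)//; rewrite ge_min lexx.
have yB : y `^ (1 - theta) <= B `^ (1 - theta).
  by apply: ge0_ler_powR; rewrite ?nnegrE ?subr_ge0//; rewrite ge_min lexx orbT.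
have -> : y = y `^ theta * y `^ (1 - theta).
  by rewrite -powRD ?subrKC ?powRr1// oner_eq0.
rewrite mulrCA [leRHS]mulrC [leRHS]mulrC.
apply: ler_pM => //; rewrite ?powR_ge0 ?mulr_ge0 ?powR_ge0//.
by apply: le_trans lamB; apply: ler_wpM2l.
Qed.

Lemma linear_le_powR theta lam x : 1 <= theta -> 0 <= lam -> 0 <= x ->
  lam <= 2^-1 -> lam * x <= x `^ theta / 2 + 2^-1.
Proof.
move=> t1 lam0 x0 lam2.
have h0 : 0 <= x `^ theta by exact: powR_ge0.
have h : x <= 1 + x `^ theta.
  have [x1|x1] := leP x 1; first by lra.
  have := le1r_powR (ltW x1) t1; lra.
have : lam * x <= 2^-1 * x by apply: ler_wpM2r.
lra.
Qed.

Lemma linear_le_sqr lam x : lam * x <= x ^+ 2 / 2 + lam ^+ 2 / 2.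
Proof. have := sqr_ge0 (x - lam); nra. Qed.

(** The constant of the admissible range of delta.  The base 2 / theta + 1 is the
    constant in log (4 N / delta) <= (2 / theta + 1) N^(theta / (2 - theta)); the
    exponent is large enough for [range_const_le] to apply both with the power
    needed for theta < 1 and with exponent zero. *)
Definition range_const theta : R := (8 * (2 / theta + 1) `^ (2 / theta))^-1.

Lemma mgf_const_ge1 theta : 1 <= mgf_const theta.
Proof. by rewrite /mgf_const lerDr mulr_ge0// powR_ge0. Qed.

Lemma range_const_gt0 theta : 0 < theta -> 0 < range_const theta.
Proof.
move=> t0; rewrite invr_gt0 mulr_gt0// powR_gt0// ltr_pwDr//.
by rewrite divr_ge0// ltW.
Qed.

Lemma range_const_le theta e : 0 < theta -> e <= 2 / theta ->
  range_const theta * (2 / theta + 1) `^ e <= 8^-1.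
Proof.
move=> t0 e2; rewrite /range_const invfM -mulrA ger_pMr ?invr_gt0//.
have M1 : 1 <= 2 / theta + 1 by rewrite lerDr divr_ge0// ltW.
rewrite mulrC ler_pdivrMr ?mul1r; first by apply: ler_powR.
by rewrite powR_gt0// (lt_le_trans ltr01).
Qed.

Lemma range_const_le8 theta : 0 < theta -> range_const theta <= 8^-1.
Proof.
move=> t0; have q0 : 0 <= 2 / theta by rewrite divr_ge0// ltW.
by have := range_const_le t0 q0; rewrite powRr0 mulr1.
Qed.

(** As delta < 1 forces c y > ln 2 >= 1 / 2, the additive constant in
    1 + log (1 / delta) is absorbed by doubling. *)
Lemma confidence_log_le (y c delta : R) : 0 < delta < 1 -> 2 * expR (- (c * y)) <= delta ->
  1 + ln (1 / delta) <= 2 * c * y /\ ln (2 / delta) <= c * y.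
Proof.
move=> /andP[d0 d1] hd.
have L2 : ln (2 / delta) <= c * y.
  rewrite ln_div ?posrE//.
  have : ln (2 * expR (- (c * y))) <= ln delta.
    by rewrite ler_ln ?posrE// mulr_gt0// expR_gt0.
  by rewrite lnM ?posrE ?expR_gt0// expRK; lra.
split=> //.
have : ln delta < 0 by apply: ln_lt0; rewrite d0.
have := ln2_ge_half R.
move: L2; rewrite !ln_div ?posrE// ln1; lra.
Qed.

(** The minimizer lam of N V lam^2 - lam s for s the [deviation] below. *)
Definition tilt theta delta (N : nat) : R :=
  Num.sqrt (1 + ln (1 / delta)) / (Num.sqrt N%:R * Num.sqrt (mgf_const theta)).

(** Chosen so that 2 N exp (- B^theta) = delta / 2. *)
Definition truncation theta delta (N : nat) : R :=
  ln (4 * N%:R / delta) `^ theta^-1.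

Lemma ln_inv_gt0 delta : 0 < delta < 1 -> 0 < ln (1 / delta).
Proof.
by move=> /andP[d0 d1]; rewrite ln_gt0// div1r invf_gt1.
Qed.

Lemma sqr_tilt theta delta (N : nat) : 0 < delta < 1 ->
  tilt theta delta N ^+ 2 = (1 + ln (1 / delta)) / (N%:R * mgf_const theta).
Proof.
move=> d01; have L0 := ln_inv_gt0 d01; have V1 := mgf_const_ge1 theta.
rewrite /tilt expr_div_n exprMn !sqr_sqrtr ?ler0n//; lra.
Qed.

(** The numerical core of [tilt_truncation_le_half]: L / (n V) is the squared
    tilt, x the square of B^(1 - theta), and t, u are the powers of the common
    scale whose product is n. *)
Lemma ratio_le_quarter (L n V c t m u x : R) : 0 < n -> 1 <= V -> 0 <= x -> 0 <= L ->
  x <= m * u -> L <= 2 * c * t -> c * m <= 8^-1 -> t * u = n ->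
  L / (n * V) * x <= 2^-1 ^+ 2.
Proof.
move=> n0 V1 x0 L0 xmu Lct cm tu.
have V0 : 0 < V by lra.
rewrite mulrAC ler_pdivrMr ?mulr_gt0//.
apply: (@le_trans _ _ (2 * c * t * (m * u))); first exact: ler_pM.
rewrite (_ : _ * _ = 2 * (c * m) * n); last by rewrite -tu; ring.
apply: (@le_trans _ _ (2 * 8^-1 * n)); first by rewrite ler_pM2r// ler_pM2l.
by rewrite expr2; nra.
Qed.

(** Everything is expressed in the scale r = N^(1 / (2 - theta)), for which
    N^(theta / (2 - theta)) = r^theta.  Then log (1 / delta) and
    log (4 N / delta) are of order r^theta, so B is of order r, and
    lam^2 B^(2 - 2 theta) is of order r^theta r^(2 - 2 theta) / N = 1. *)
Lemma tilt_truncation_le_half theta delta (N : nat) : 0 < theta < 1 -> (0 < N)%N ->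
  0 < delta < 1 ->
  2 * expR (- (range_const theta * N%:R `^ (theta / (2 - theta)))) <= delta ->
  tilt theta delta N * truncation theta delta N `^ (1 - theta) <= 2^-1.
Proof.
move=> /andP[t0 t1] N0 d01 hd.
have /andP[d0 d1] := d01.
have L0 := ln_inv_gt0 d01; have V1 := mgf_const_ge1 theta.
have [L1 L2] := confidence_log_le d01 hd.
set r : R := N%:R `^ (2 - theta)^-1.
have N1 : 1 <= N%:R :> R by rewrite ler1n.
have Npos : 0 < N%:R :> R by rewrite ltr0n.
have r1 : 1 <= r by rewrite -(powRr0 N%:R) ler_powR// invr_ge0; lra.
have r0 : 0 < r by lra.
have rN : r `^ (2 - theta) = N%:R.
  by rewrite /r -powRrM mulVf ?powRr1//; lra.
have rp : N%:R `^ (theta / (2 - theta)) = r `^ theta.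
  by rewrite /r -powRrM mulrC.
rewrite {}rp in hd L1 L2.
set c := range_const theta in hd L1 L2.
set M := 2 / theta + 1.
have M1 : 1 <= M by rewrite /M lerDr divr_ge0// ltW.
have c0 : 0 < c by exact: range_const_gt0.
have c1 : c <= 1.
  by have := range_const_le8 t0; rewrite -/c; lra.
have rt1 : 1 <= r `^ theta by rewrite -(powRr0 r) ler_powR// ltW.
have beta_ge0 : 0 <= ln (4 * N%:R / delta).
  apply: ln_ge0; rewrite ler_pdivlMr// mul1r; lra.
have beta_le : ln (4 * N%:R / delta) <= M * r `^ theta.
  have -> : 4 * N%:R / delta = 2 * N%:R * (2 / delta) by field; rewrite gt_eqF.
  rewrite lnM ?posrE ?divr_gt0 ?mulr_gt0// lnM ?posrE//.
  (* ln N is a multiple of ln (r^theta), hence at most that multiple of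
     r^theta *)
  have lnN : ln (N%:R : R) <= (2 / theta - 1) * r `^ theta.
    rewrite -rN ln_powR.
    have := ltW (ln_sublinear (lt_le_trans ltr01 rt1)).
    rewrite ln_powR => h.
    rewrite (_ : (2 - theta) * ln r = (2 / theta - 1) * (theta * ln r)); last first.
      by field; rewrite gt_eqF.
    by apply: ler_wpM2l => //; rewrite subr_ge0 ler_pdivlMr//; lra.
  have ln2 : ln (2 : R) <= 1.
    rewrite -[leRHS]expRK ler_ln ?posrE ?expR_gt0//.
    by have := expR_ge1Dx (1 : R); lra.
  have : c * r `^ theta <= r `^ theta by rewrite ger_pMl//; lra.
  rewrite /M; move: L2 lnN; rewrite !mulrDl; lra.
have B_le : truncation theta delta N `^ (1 - theta) <=
    M `^ ((1 - theta) / theta) * r `^ (1 - theta).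
  rewrite /truncation -powRrM (mulrC theta^-1).
  rewrite (_ : r `^ (1 - theta) = (r `^ theta) `^ ((1 - theta) / theta)); last first.
    by rewrite -powRrM; congr (_ `^ _); field; rewrite gt_eqF.
  rewrite -powRM; [|lra|exact: powR_ge0].
  have Mr0 : 0 <= M * r `^ theta by rewrite mulr_ge0 ?powR_ge0//; lra.
  apply: ge0_ler_powR; rewrite ?nnegrE//.
  by rewrite divr_ge0// ?subr_ge0 ltW.
rewrite -ler_sqr ?nnegrE ?mulr_ge0 ?powR_ge0 ?divr_ge0 ?mulr_ge0 ?sqrtr_ge0//.
rewrite exprMn sqr_tilt//.
have B2 : (truncation theta delta N `^ (1 - theta)) ^+ 2 <=
    M `^ (2 * (1 - theta) / theta) * r `^ (2 - 2 * theta).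
  rewrite (_ : _ * _ = (M `^ ((1 - theta) / theta) * r `^ (1 - theta)) ^+ 2).
    by rewrite ler_sqr ?nnegrE ?mulr_ge0 ?powR_ge0.
  rewrite exprMn !sqr_powR mulrA; congr (_ * _ `^ _); ring.
have cM := range_const_le t0 (_ : 2 * (1 - theta) / theta <= 2 / theta).
have cM8 : c * M `^ (2 * (1 - theta) / theta) <= 8^-1.
  by apply: cM; rewrite ler_pM2r ?invr_gt0// ler_piMr// lerBlDr lerDl ltW.
have rN' : r `^ theta * r `^ (2 - 2 * theta) = N%:R.
  rewrite -powRD; last by rewrite (gt_eqF r0) implybT.
  by rewrite (_ : theta + _ = 2 - theta)//; ring.
exact: (ratio_le_quarter Npos V1 (sqr_ge0 _) (addr_ge0 ler01 (ltW L0)) B2 L1 cM8 rN').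
Qed.

Lemma tilt_le_half theta delta (N : nat) : 0 < theta -> (0 < N)%N ->
  0 < delta < 1 -> 2 * expR (- (range_const theta * N%:R)) <= delta ->
  tilt theta delta N <= 2^-1.
Proof.
move=> t0 N0 d01 hd; have [L1 _] := confidence_log_le d01 hd.
have L0 := ln_inv_gt0 d01; have V1 := mgf_const_ge1 theta.
have Npos : 0 < N%:R :> R by rewrite ltr0n.
have c8 := range_const_le8 t0.
rewrite -ler_sqr ?nnegrE ?divr_ge0 ?mulr_ge0 ?sqrtr_ge0// sqr_tilt//.
rewrite invfM mulrA ler_pdivrMr; last by lra.
apply: (@le_trans _ _ (2 * range_const theta)).
  by rewrite ler_pdivrMr.
rewrite expr2; nra.
Qed.

Lemma admissible_delta_in01 theta delta (N : nat) :
  admissible_delta theta (range_const theta) N delta -> 0 < delta < 1.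
Proof.
rewrite /admissible_delta; case: ifPn => _; [|case: ifPn => _]; rewrite /= in_itv//=.
- by move=> /andP[h ->]; rewrite andbT (lt_le_trans _ h)// mulr_gt0// expR_gt0.
- by move=> /andP[h ->]; rewrite andbT (lt_le_trans _ h)// mulr_gt0// expR_gt0.
Qed.

Lemma truncated_exponent_le theta delta (N : nat) : 0 < theta <= 2 -> (0 < N)%N ->
  admissible_delta theta (range_const theta) N delta ->
  forall x, 0 <= x ->
    tilt theta delta N * Num.min x (truncation theta delta N) <=
    x `^ theta / 2 + 2^-1 + tilt theta delta N ^+ 2 / 2.
Proof.
move=> /andP[t0 t2] N0 adm x x0; set lam := tilt theta delta N.
have d01 := admissible_delta_in01 adm.
have lam0 : 0 <= lam by rewrite divr_ge0 ?mulr_ge0 ?sqrtr_ge0.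
have lam2 := sqr_ge0 lam.
have B0 : 0 <= truncation theta delta N by exact: powR_ge0.
have minx : lam * Num.min x (truncation theta delta N) <= lam * x.
  by apply: ler_wpM2l => //; rewrite ge_min lexx.
move: adm; rewrite /admissible_delta.
case: ifPn => [t1|]; [|rewrite -leNgt => t1; case: ifPn => [t2'|]].
- rewrite /= in_itv/= => /andP[hd _].
  have := @tilt_truncation_le_half theta delta N _ N0 d01 hd; rewrite t0 t1 => /(_ isT) h.
  have := @truncated_linear_le_powR theta lam _ x _ lam0 x0 B0 h.
  rewrite t0 ltW// => /(_ isT); lra.
- rewrite /= in_itv/= => /andP[hd _].
  have := linear_le_powR t1 lam0 x0 (tilt_le_half t0 N0 d01 hd); lra.
- rewrite -leNgt => t2' _.
  have theta2 : theta = 2 by apply: le_anti; rewrite t2 t2'.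
  have -> : x `^ theta = x ^+ 2 by rewrite theta2 powR_mulrn.
  by have := linear_le_sqr lam x; lra.
Qed.

(** The deviation s of the rescaled sum to which the tilt is adapted. *)
Definition deviation theta delta (N : nat) : R :=
  2 * Num.sqrt (mgf_const theta) *
  (Num.sqrt N%:R * Num.sqrt (1 + ln (1 / delta))).

Lemma tail_bound_le theta delta (N : nat) :
  0 < theta -> (0 < N)%N -> 0 < delta < 1 ->
  expR (N%:R * (mgf_const theta * tilt theta delta N ^+ 2) -
        tilt theta delta N * deviation theta delta N) +
  N%:R * (2 * expR (- truncation theta delta N `^ theta)) <= delta.
Proof.
move=> t0 N0 d01.
have /andP[d0 d1] := d01.
have L0 := ln_inv_gt0 d01; have V1 := mgf_const_ge1 theta.
have Npos : 0 < N%:R :> R by rewrite ltr0n.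
have N1 : 1 <= N%:R :> R by rewrite ler1n.
have -> : N%:R * (mgf_const theta * tilt theta delta N ^+ 2) = 1 + ln (1 / delta).
  by rewrite sqr_tilt//; field; rewrite !gt_eqF//; lra.
have -> : tilt theta delta N * deviation theta delta N = 2 * (1 + ln (1 / delta)).
  rewrite -[in RHS](sqr_sqrtr (_ : 0 <= 1 + ln (1 / delta))); last by lra.
  rewrite /deviation /tilt; field.
  by rewrite !gt_eqF// sqrtr_gt0//; lra.
rewrite /truncation -powRrM mulVf ?gt_eqF// powRr1; last first.
  apply: ln_ge0; rewrite ler_pdivlMr// mul1r; lra.
rewrite expRN lnK ?posrE ?divr_gt0 ?mulr_gt0// (_ : _ - _ = - 1 + ln delta); last first.
  by rewrite ln_div ?posrE// ln1; ring.
rewrite expRD lnK ?posrE// expRN.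
have e2 : 2 <= expR (1 : R) by have := expR_ge1Dx (1 : R); lra.
have : (expR 1)^-1 <= 2^-1 :> R by rewrite lef_pV2 ?posrE ?expR_gt0.
have -> : N%:R * (2 * (4 * N%:R / delta)^-1) = delta / 2.
  by field; rewrite !gt_eqF.
nra.
Qed.

End parameters.

(** * Concentration of the sample mean *)

(** The infimum need not be known to be attained: an admissible c below 2 K is
    enough, and the factor 2 goes into the final constant. *)
Lemma psi_norm_le_integral {R : realType} {d : measure_display}
    {T : measurableType d} (P : probability T R) (theta K : R) (W : T -> R) :
  0 < K -> measurable_fun [set: T] W -> (psi_norm P theta W <= K%:E)%E ->
  exists c, [/\ 0 < c, c < 2 * K &
    (\int[P]_x (expR ((`|W x| / c) `^ theta))%:E <= 2%:E)%E].
Proof.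
move=> K0 mW normW.
have : (psi_norm P theta W < (2 * K)%:E)%E.
  by apply: le_lt_trans normW _; rewrite lte_fin; lra.
move=> /ereal_inf_lt[_ [c [c0 +] <-]]; rewrite lte_fin => Ec cK.
exists c; split=> //.
move: Ec; rewrite unlock => Ec.
have mexp : measurable_fun [set: T] (fun x => expR ((`|W x| / c) `^ theta)).
  apply: measurableT_comp => //; apply: (measurableT_comp (measurable_powR theta)).
  by apply: measurable_funM => //; exact: measurableT_comp.
have e1 x : 1 <= expR ((`|W x| / c) `^ theta) by rewrite -[leLHS]expR0 ler_expR powR_ge0.
under eq_integral do rewrite -(subrK 1 (expR _)) EFinD.
rewrite ge0_integralD//.
- rewrite (_ : 2%:E = 1 + 1)%E; last by rewrite -EFinD.
  by rewrite integral_cst// [X in (_ * X)%E](probability_setT P) mule1 leeD.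
- by move=> x _; rewrite lee_fin subr_ge0.
- by apply/measurable_EFinP; exact: measurable_funB.
Qed.

(** The samples of Z = (E f - f) / c sum to N / c times the gap between the two
    means.  A gap beyond the stated bound makes this sum exceed the deviation
    of [tail_bound_le], the constant 4 being twice the 2 found there because
    c < 2 K. *)
Lemma sample_mean_lower_tail {R : realType} {d d' : measure_display}
    {T : measurableType d} {T' : measurableType d'} (P : probability T R)
    (Q : probability T' R) (N : nat) (X : 'I_N -> {RV P >-> T'})
    (theta K delta : R) (f : T' -> R) :
  0 < theta <= 2 -> (0 < N)%N -> 0 < K -> iid_sample Q X ->
  measurable_fun [set: T'] f ->
  (psi_norm Q theta (fun u => f u - fine 'E_Q[f])%R <= K%:E)%E ->
  admissible_delta theta (range_const theta) N delta ->
  (P [set w | (fine 'E_Q[f] - empirical_mean (fun i => X i w) f <=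
     4 * Num.sqrt (mgf_const theta) * K / Num.sqrt N%:R *
     Num.sqrt (1 + ln (1 / delta)))%R] >= (1 - delta)%:E)%E.
Proof.
move=> theta_range N0 K0 iidX mf normf adm.
have [t0 t2] := andP theta_range.
set mean : R := fine 'E_Q[f] in normf *.
have mW : measurable_fun [set: T'] (fun u => f u - mean) by exact: measurable_funB.
have [c [c0 cK Ec]] := psi_norm_le_integral K0 mW normf.
pose Z u := (mean - f u) / c.
have mZ : measurable_fun [set: T'] Z.
  by apply: measurable_funM => //; exact: measurable_funB.
have Z_exp : (\int[Q]_x (expR (`|Z x| `^ theta))%:E <= 2%:E)%E.
  apply: le_trans Ec; rewrite le_eqVlt; apply/orP; left; apply/eqP.
  apply: eq_integral => x _; congr (expR (_ `^ _))%:E.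
  by rewrite normrM distrC ger0_norm// invr_ge0 ltW.
have iZ := integrable_of_exp_powR t0 mZ Z_exp.
have fE : (EFin \o f) = (fun u => mean%:E - c%:E * (Z u)%:E)%E.
  apply/funext => u /=; congr EFin.
  by rewrite /Z; field; rewrite gt_eqF.
have iC : Q.-integrable [set: T'] (fun=> mean%:E).
  exact: finite_measure_integrable_cst.
have icZ : Q.-integrable [set: T'] (fun u => (c%:E * (Z u)%:E)%E).
  exact: integrableZl.
have Zfin : (\int[Q]_x (Z x)%:E)%E \is a fin_num by exact: integrable_fin_num.
have Ef : ('E_Q[f] = mean%:E - c%:E * \int[Q]_x (Z x)%:E)%E.
  rewrite unlock; under eq_integral do rewrite -[(f _)%:E]/((EFin \o f) _) fE.
  rewrite integralB// integralZl// integral_cst//.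
  by rewrite [X in (_ * X - _)%E](probability_setT Q) mule1.
(* once f is known to be integrable, its extended expectation is the real
   number mean, so Z is centred *)
have Z_mean : (\int[Q]_x (Z x)%:E <= 0)%E.
  move: Ef; rewrite -(fineK Zfin); set z := fine (\int[Q]_x _)%E => Ef.
  have : mean = mean - c * z by rewrite {1}/mean Ef.
  move=> cz; have /eqP : c * z = 0 by lra.
  by rewrite mulf_eq0 gt_eqF//= => /eqP ->.
have d01 := admissible_delta_in01 adm.
have lam0 : 0 <= tilt theta delta N by rewrite divr_ge0 ?mulr_ge0 ?sqrtr_ge0.
have B0 : 0 <= truncation theta delta N by exact: powR_ge0.
have bad := sample_sum_tail iidX t0 mZ Z_exp Z_mean
  (deviation theta delta N) lam0 B0 (truncated_exponent_le theta_range N0 adm).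
have := tail_bound_le t0 N0 d01; rewrite -lee_fin => /(le_trans bad) {}bad.
set good := [set w | _ <= 4 * _ * _ / _ * _].
have mfX i : measurable_fun [set: T] (fun w => f (X i w)).
  by apply: (measurableT_comp mf).
have mZX i : measurable_fun [set: T] (fun w => Z (X i w)).
  by apply: (measurableT_comp mZ).
have mgood : measurable good.
  apply: measurable_set_ler => //; apply: measurable_funB => //.
  by apply: measurable_funM => //; exact: measurable_sum.
have mbad : measurable [set w | deviation theta delta N <= \sum_i Z (X i w)].
  by apply: measurable_set_ler => //; exact: measurable_sum.
have sub : ~` good `<=` [set w | deviation theta delta N <= \sum_i Z (X i w)].
  move=> w /= /negP; rewrite -ltNge => hw.
  have Npos : 0 < N%:R :> R by rewrite ltr0n.
  have -> : \sum_i Z (X i w) =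
      N%:R * (mean - empirical_mean (fun i => X i w) f) / c.
    rewrite /Z -mulr_suml sumrB sumr_const card_ord /empirical_mean.
    by rewrite mulrBr mulVKf ?gt_eqF// mulr_natl.
  rewrite ler_pdivlMr//; apply: (@le_trans _ _ (N%:R * (4 * Num.sqrt (mgf_const theta) * K /
    Num.sqrt N%:R * Num.sqrt (1 + ln (1 / delta))))); last first.
    by rewrite ler_pM2l// ltW.
  have sN : 0 < Num.sqrt (N%:R : R) by rewrite sqrtr_gt0.
  rewrite -{1}(sqr_sqrtr (ltW Npos)).
  rewrite (_ : Num.sqrt N%:R ^+ 2 * _ = deviation theta delta N * (2 * K)); last first.
    by rewrite /deviation; field; rewrite gt_eqF.
  by apply: ler_wpM2l; rewrite ?mulr_ge0 ?sqrtr_ge0// ltW.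
have Pgood : P good = (1 - P (~` good))%E.
  by rewrite -probability_setC ?setCK//; exact: measurableC.
rewrite Pgood EFinB leeB//; apply: le_trans bad.
by apply: le_measure; rewrite ?inE//; exact: measurableC.
Qed.

(** * Measurability of the loss *)

Section loss_measurability.
Context {R : realType}.

(** The Borel structure is generated by the open sets of the space of columns,
    so continuity of the coordinates gives their measurability. *)
Lemma measurable_coord (D : nat) (i : 'I_D) :
  measurable_fun [set: borel_vec R D] (fun u : borel_vec R D => (u : 'cV[R]_D) i ord0).
Proof.
apply: (measurability _ (RGenOpens.measurableE R)) => _ [_ [x [y ->]] <-].
rewrite setTI; apply: sub_sigma_algebra.
have /continuousP : continuous (fun u : 'cV[R]_D => u i ord0).
  exact: coord_continuous.
by apply; exact: interval_open.
Qed.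

Lemma measurable_max_affine_loss (Dx D J : nat)
    (a : 'I_J.+1 -> 'cV[R]_Dx -> 'cV[R]_D) (b : 'I_J.+1 -> 'cV[R]_Dx -> R) z :
  measurable_fun [set: borel_vec R D] (max_affine_loss a b z).
Proof.
rewrite /max_affine_loss.
pose piece j (u : borel_vec R D) := ((a j z)^T *m (u : 'cV[R]_D)) ord0 ord0 + b j z.
have mp j : measurable_fun [set: borel_vec R D] (piece j).
  apply: measurable_funD => //.
  under eq_fun do rewrite mxE.
  apply: measurable_sum => i; apply: measurable_funM => //.
  exact: measurable_coord.
rewrite (_ : (fun u => _) = \big[(fun f g u => Num.max (f u) (g u))/piece ord0]_j piece j); last first.
  apply/funext => u; elim/big_rec2 : _ => // j y f _ ->. by [].
elim/big_rec : _ => // j f _ mf.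
exact: measurable_maxr.
Qed.

End loss_measurability.

(** * The sample-average bound for piecewise affine losses *)

Theorem proposition3 (R : realType) (theta : R) (theta_range : 0 < theta <= 2) :
  exists C c : R, [/\ 0 < C, 0 < c &
    forall (Dx Dxi J : nat)
      (X : set 'cV[R]_Dx) (X_compact : compact X) (X_convex : convex_set X)
      (Xi : set 'cV[R]_Dxi)
      (Pstar : probability (borel_vec R Dxi) R)
      (Pstar_Xi : {ae Pstar, forall u, Xi u})
      (a : 'I_J.+1 -> 'cV[R]_Dx -> 'cV[R]_Dxi)
      (b : 'I_J.+1 -> 'cV[R]_Dx -> R^o)
      (a_affine : forall j, affine_map (a j))
      (b_affine : forall j, affine_map (b j))
      (K : R) (K_gt0 : 0 < K)
      (psi_bound : forall z, X z ->
        (psi_norm Pstar theta (fun u => max_affine_loss a b z u -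
           fine 'E_Pstar[max_affine_loss a b z])%R <= K%:E)%E)
      (d : measure_display) (Omega : measurableType d)
      (Pr : probability Omega R)
      (N : nat) (N_gt0 : (0 < N)%N)
      (xi : 'I_N -> {RV Pr >-> borel_vec R Dxi})
      (xi_iid : iid_sample Pstar xi)
      (z : 'cV[R]_Dx) (z_X : X z)
      (delta : R) (delta_range : admissible_delta theta c N delta),
      (Pr [set w : Omega |
             (fine 'E_Pstar[max_affine_loss a b z] -
               empirical_mean (fun i => xi i w) (max_affine_loss a b z) <=
             C * K / Num.sqrt N%:R * Num.sqrt (1 + ln (1 / delta)))%R]
       >= (1 - delta)%:E)%E].
Proof.
have [theta_gt0 _] := andP theta_range.
exists (4 * Num.sqrt (mgf_const theta)), (range_const theta); split.
- by rewrite mulr_gt0// sqrtr_gt0 (lt_le_trans ltr01)// mgf_const_ge1.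
- exact: range_const_gt0.
move=> Dx Dxi J X _ _ Xi Pstar _ a b _ _ K K_gt0 psi_bound d Omega Pr N N_gt0.
move=> xi xi_iid z z_X delta delta_range.
apply: (sample_mean_lower_tail theta_range N_gt0 K_gt0 xi_iid) => //.
- exact: measurable_max_affine_loss.
- exact: psi_bound.
Qed.
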